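(* Let $G_S$ be a self-loop graph of order $n\geq 2$ and size $m\geq 1$. Let $r,s,t$ be nonnegative real numbers with $4r=s+t+2$. Then \[ \mathcal E(G_S)\geq\frac{\mathcal M_r(G_S)^2}{\sqrt{\mathcal M_s(G_S)\,\mathcal M_t(G_S)}}. \]
   Context: A self-loop graph $G_S$ is obtained from a simple graph $G$ with $n$ vertices and $m$ edges by attaching one loop at each vertex of $S\subseteq V(G)$, $|S|=\sigma$; its adjacency matrix is that of $G$ with diagonal entry $1$ at vertices of $S$, and $\lambda_1\geq\cdots\geq\lambda_n$ are its eigenvalues. For real $q\geq0$, $\mathcal M_q(G_S)=\sum_{i=1}^n\left|\lambda_i-\frac{\sigma}{n}\right|^q$ (with $0^0=1$), and $\mathcal E(G_S)=\mathcal M_1(G_S)$ is the energy of $G_S$. *)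

(* Defs.v *)
From mathcomp Require Import all_boot all_order all_algebra.
From mathcomp Require Import all_classical all_reals all_analysis.
From mathcomp Require Import polyrcf complex.

Set Implicit Arguments.
Unset Strict Implicit.
Unset Printing Implicit Defensive.

Import Order.TTheory GRing.Theory Num.Theory.
Local Open Scope ring_scope.

Record self_loop_graph := SelfLoopGraph {
  vertex : finType;
  edge : rel vertex;
  edge_sym : symmetric edge;
  edge_irr : irreflexive edge;
  loops : {set vertex} }.

Definition graph_order (G : self_loop_graph) : nat := #|vertex G|.

(* Loops are not counted: this is the number of edges of the underlying simple
   graph, an edge being an unordered pair of adjacent vertices. *)
Definition graph_size (G : self_loop_graph) : nat :=
  #|[set [set p.1; p.2] | p : vertex G * vertex G & edge p.1 p.2]|.

Definition adjacency (R : realType) (G : self_loop_graph) :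
    'M[R]_(graph_order G) :=
  \matrix_(i, j)
    (let u : vertex G := enum_val i in let v : vertex G := enum_val j in
     edge u v || (u == v) && (u \in loops G))%:R.

(* Real roots of the characteristic polynomial, each repeated according to its
   multiplicity, in nonincreasing order.  A symmetric matrix has no other
   eigenvalues: see char_poly_eigenvalues and size_eigenvalues below. *)
Definition eigenvalues (R : realType) (n : nat) (A : 'M[R]_n) : seq R :=
  sort (fun x y => y <= x)
    (flatten [seq nseq (mup x (char_poly A)) x | x <- rootsR (char_poly A)]).

(* powR satisfies the convention that zero to the power zero is one. *)
Definition moment (R : realType) (q : R) (G : self_loop_graph) : R :=
  \sum_(l <- eigenvalues (adjacency R G))
    `| l - #|loops G|%:R / (graph_order G)%:R | `^ q.

Definition energy (R : realType) (G : self_loop_graph) : R := moment 1 G.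

Lemma adjacency_sym (R : realType) (G : self_loop_graph) :
  (adjacency R G)^T = adjacency R G.
Proof.
apply/matrixP => i j; rewrite !mxE /= edge_sym.
by case: (eqVneq (enum_val j) (enum_val i)) => [->|].
Qed.

Lemma eigenvalues_sorted (R : realType) (n : nat) (A : 'M[R]_n) :
  sorted (fun x y => y <= x) (eigenvalues A).
Proof. by apply: sort_sorted => x y; exact: le_total. Qed.

Lemma char_poly_similar (F : fieldType) (n : nat) (P D : 'M[F]_n) :
  P \in unitmx -> char_poly (invmx P *m D *m P) = char_poly D.
Proof.
move=> Pu; rewrite /char_poly.
have -> : char_poly_mx (invmx P *m D *m P) =
    map_mx polyC (invmx P) *m char_poly_mx D *m map_mx polyC P.
  rewrite /char_poly_mx !map_mxM /= mulmxBr mulmxBl; congr (_ - _).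
  rewrite -mulmxA -scalar_mxC mulmxA -map_mxM mulVmx // map_mx1.
  by rewrite mul1mx.
rewrite !det_mulmx mulrAC -det_mulmx -map_mxM mulVmx //.
by rewrite map_mx1 det1 mul1r.
Qed.

Lemma sym_char_poly_split (R : realType) (n : nat) (A : 'M[R]_n) :
  A^T = A -> exists s : seq R, char_poly A = \prod_(x <- s) ('X - x%:P).
Proof.
move=> symA; pose C : numClosedFieldType := complex R.
pose f : {rmorphism R -> C} := real_complex R.
pose B : 'M[C]_n := map_mx f A.
have fReal x : f x \is Num.real by apply/complex_realP; exists x.
have Bherm : B \is hermsymmx.
  apply: realsym_hermsym.
    apply/is_hermitianmxP; rewrite expr0 scale1r map_mx_id //.
    by rewrite /B map_trmx symA.
  by apply/mxOverP => i j; rewrite mxE.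
have /orthomx_spectralP Beq := hermitian_normalmx Bherm.
have dreal := hermitian_spectral_diag_real Bherm.
pose d i := complex.Re (spectral_diag B 0 i).
have dE i : f (d i) = spectral_diag B 0 i.
  have /mxOverP /(_ 0 i) := dreal; rewrite /d.
  by move=> /RRe_real.
exists [seq d i | i <- enum 'I_n].
apply: (map_inj_poly (f := f)); [exact: fmorph_inj | exact: rmorph0 |].
rewrite map_char_poly -/B Beq char_poly_similar ?spectral_unit //.
rewrite char_poly_trig ?diag_mx_is_trig // big_map big_enum rmorph_prod /=.
apply: eq_bigr => i _.
by rewrite rmorphB /= map_polyX map_polyC /= dE mxE eqxx mulr1n.
Qed.

Lemma count_eigenvalues (R : realType) (n : nat) (A : 'M[R]_n) (x : R) :
  count_mem x (eigenvalues A) = mup x (char_poly A).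
Proof.
rewrite /eigenvalues; set p := char_poly A.
have p0 : p != 0 by exact/monic_neq0/char_poly_monic.
rewrite count_sort count_flatten -map_comp.
under eq_map => y do rewrite /= count_nseq /=.
rewrite sumnE big_map.
have Uroots : uniq (rootsR p).
  exact: (sorted_uniq lt_trans ltxx (sorted_roots _ _ _)).
have [xr | xNr] := boolP (root p x); last first.
  rewrite mupNroot // big1_seq // => y /andP[_ _].
  by case: eqVneq => [->|_]; rewrite ?mul0n // mul1n mupNroot.
have xin : x \in rootsR p.
  by have := roots_on_rootsR p0 x; rewrite xr in_itv /= => <-.
rewrite (bigD1_seq x) //= eqxx mul1n big1 ?addn0 // => y /negPf.
by move=> ->; rewrite mul0n.
Qed.

Lemma char_poly_eigenvalues (R : realType) (n : nat) (A : 'M[R]_n) :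
  A^T = A -> char_poly A = \prod_(x <- eigenvalues A) ('X - x%:P).
Proof.
move=> /sym_char_poly_split [s As]; rewrite As; apply: perm_big.
by apply/allP => x _ /=; rewrite count_eigenvalues As mu_prod_XsubC.
Qed.

Lemma size_eigenvalues (R : realType) (n : nat) (A : 'M[R]_n) :
  A^T = A -> size (eigenvalues A) = n.
Proof.
move=> /char_poly_eigenvalues /(congr1 (fun p : {poly R} => size p)).
by rewrite size_char_poly size_prod_XsubC => -[].
Qed.

(* Main.v *)
(** Write [a] for the distances of the eigenvalues to their mean.  As [s + t] is
    nonnegative, [r] is positive, so that [a ^ r = a ^ (1/2) * (a ^ (s/4) * a ^ (t/4))]
    even when [a = 0].  Two applications of the Cauchy-Schwarz inequality give
    [M_r ^ 2 <= M_1 * \sum (a ^ (s/2) * a ^ (t/2))] and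
    [(\sum (a ^ (s/2) * a ^ (t/2))) ^ 2 <= M_s * M_t]. *)
Require Import Defs.
From mathcomp Require Import all_boot all_order all_algebra.
From mathcomp Require Import all_classical all_reals all_analysis.
From mathcomp Require Import ring lra.
Import Order.TTheory GRing.Theory Num.Theory.
Local Open Scope ring_scope.

(** By Lagrange's identity, twice the right side minus the left is a double sum of squares. *)
Lemma sum_CauchySchwarz (R : realDomainType) (I : Type) (l : seq I)
    (f g : I -> R) :
  (\sum_(i <- l) f i * g i) ^+ 2 <=
    (\sum_(i <- l) f i ^+ 2) * (\sum_(i <- l) g i ^+ 2).
Proof.
set fg := \sum_(i <- l) f i * g i.
set ff := \sum_(i <- l) f i ^+ 2; set gg := \sum_(i <- l) g i ^+ 2.
have lagrange : \sum_(i <- l) \sum_(j <- l) (f i * g j - f j * g i) ^+ 2 =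
    2 * (ff * gg - fg ^+ 2).
  transitivity (\sum_(i <- l)
      (f i ^+ 2 * gg + g i ^+ 2 * ff - f i * g i * (2 * fg))).
    apply: eq_bigr => i _; rewrite /ff /gg /fg !mulr_sumr -sumrN -!big_split.
    by apply: eq_bigr => j _ /=; ring.
  rewrite !big_split /= sumrN -!mulr_suml -/ff -/gg -/fg; ring.
rewrite -subr_ge0 -(pmulr_rge0 _ (ltr0Sn R 1)) -lagrange.
by do 2![apply: sumr_ge0 => ? _]; exact: sqr_ge0.
Qed.

Lemma sqr_powR_half (R : realType) (a q : R) : (a `^ (q / 2)) ^+ 2 = a `^ q.
Proof. by rewrite -powR_mulrn ?powR_ge0 // -powRrM divfK ?pnatr_eq0. Qed.

Lemma sum_powR_interpolation (R : realType) (I : Type) (l : seq I) (a : I -> R)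
    (r s t : R) (hs : 0 <= s) (ht : 0 <= t) (hrst : 4 * r = s + t + 2) :
  (\sum_(i <- l) a i `^ r) ^+ 2 <=
    (\sum_(i <- l) a i `^ 1) *
    Num.sqrt ((\sum_(i <- l) a i `^ s) * (\sum_(i <- l) a i `^ t)).
Proof.
(* Each of the two Cauchy-Schwarz steps squares the factors and so removes one halving from
   [s / 2 / 2] and [t / 2 / 2]. *)
have factor i : a i `^ r =
    a i `^ (1 / 2) * (a i `^ (s / 2 / 2) * a i `^ (t / 2 / 2)).
  have [-> | a0] := eqVneq (a i) 0.
    by rewrite (@powR0 _ r) ?(@powR0 _ (1 / 2)) ?mul0r //; apply: lt0r_neq0; lra.
  rewrite -!powRD ?a0 ?implybT //; congr (_ `^ _); lra.
under eq_bigr do rewrite factor.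
apply: le_trans (sum_CauchySchwarz _ _ _ _ _) _.
under eq_bigr do rewrite sqr_powR_half.
apply: ler_wpM2l; first by apply: sumr_ge0 => i _; exact: powR_ge0.
under eq_bigr do rewrite exprMn !sqr_powR_half.
(* Bounding the sum by the root of its square lets Cauchy-Schwarz apply under the root. *)
apply: le_trans (ler_norm _) _; rewrite -sqrtr_sqr; apply: ler_wsqrtr.
apply: le_trans (sum_CauchySchwarz _ _ _ _ _) _.
by under eq_bigr do rewrite sqr_powR_half;
   under [X in _ * X <= _]eq_bigr do rewrite sqr_powR_half.
Qed.

Theorem theorem3p10 (R : realType) (G : self_loop_graph)
    (hn : (2 <= graph_order G)%N) (hm : (1 <= graph_size G)%N)
    (r s t : R) (hr : 0 <= r) (hs : 0 <= s) (ht : 0 <= t)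
    (hrst : 4 * r = s + t + 2) :
  energy R G >= moment r G ^+ 2 / Num.sqrt (moment s G * moment t G).
Proof.
have := sqrtr_ge0 (moment s G * moment t G); rewrite le0r.
case/predU1P => [-> | h].
  (* If the root vanishes, the quotient is 0 because [0^-1 = 0], and the energy is nonnegative. *)
  by rewrite invr0 mulr0; apply: sumr_ge0 => l _; exact: powR_ge0.
by rewrite ler_pdivrMr //; exact: sum_powR_interpolation.
Qed.
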